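(* In virtual equipment type theory (VETT), let $\mathbb C$ be a small category, and consider variables $\pi:\mathcal P^+\mathbb C$ (contravariant) and $\alpha:\mathbb C$ (covariant). Then, as sets (profunctors) in set context $\pi:\mathcal P^+\mathbb C;\alpha:\mathbb C$: 1. (Yoneda) the set $(\alpha\to_{\mathbb C}\alpha')\triangleright^{\forall\alpha':\mathbb C}(\pi\ni\alpha')$ is isomorphic to $\pi\ni\alpha$; 2. (Co-Yoneda) the set $(\pi\ni\alpha')\odot^{\exists\alpha':\mathbb C}(\alpha'\to_{\mathbb C}\alpha)$ is isomorphic to $\pi\ni\alpha$.
   Context: **Judgments of VETT.** All judgments are relative to a context $\Gamma$ (suppressed below) of an extensional Martin-Löf dependent type theory. (i) Categories $\mathbb C$ Cat, some of which are small. (ii) Objects (functors) $\alpha:\mathbb C\vdash a:\mathbb D$, with exactly one free variable; variable rule $\alpha:\mathbb C\vdash\alpha:\mathbb C$. (iii) Sets (profunctors) $\Xi\vdash R$ Set, where a set context $\Xi$ is either $\alpha:\mathbb C$ or $\alpha:\mathbb C;\beta:\mathbb D$ (first variable contravariant, second covariant). In the first case $d^-\Xi=d^+\Xi=(\alpha:\mathbb C)$; in the second $d^-\Xi=(\alpha:\mathbb C)$, $d^+\Xi=(\beta:\mathbb D)$. (iv) Elements (natural transformations) $\Phi\vdash s:R$. A transformation context is $\Phi=\alpha_1:\mathbb C_1,x_1:R_1,\alpha_2:\mathbb C_2,\dots,x_n:R_n,\alpha_{n+1}:\mathbb C_{n+1}$ ($n\ge0$), each $R_i$ a set in context $\alpha_i:\mathbb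 C_i;\alpha_{i+1}:\mathbb C_{i+1}$. Put $d^-\Phi=\alpha_1:\mathbb C_1$, $d^+\Phi=\alpha_{n+1}:\mathbb C_{n+1}$, and $\underline\Phi=(\alpha_1:\mathbb C_1)$ if $n=0$, $\underline\Phi=d^-\Phi;d^+\Phi$ otherwise; $R$ must be a set in context $\underline\Phi$. Variable rule: $\alpha:\mathbb C,x:R,\beta:\mathbb D\vdash x:R$ (ordered, linear). If $d^+\Phi=d^-\Psi$, $\Phi\Join\Psi$ is concatenation sharing the common variable. **Substitution (admissible).** Objects substitute for object variables in objects; $R[a/\alpha;b/\beta]$ is a set in $\Xi$ when $R$ is a set in $\alpha:\mathbb C;\beta:\mathbb D$, $d^-\Xi\vdash a:\mathbb C$, $d^+\Xi\vdash b:\mathbb D$. A transformation substitution $\Psi\vdash\phi::\Phi$ is $\phi=a_1/\alpha_1,s_1/x_1,a_2/\alpha_2,\dots,s_n/x_n,a_{n+1}/\alpha_{n+1}$ with $\Psi=\Psi_1\Join\dots\Join\Psi_n$, $d^-\Psi_i\vdash a_i:\mathbb C_i$, $d^+\Psi_i\vdash a_{i+1}:\mathbb C_{i+1}$, $\Psi_i\vdash s_i:R_i[a_i/\alpha_i;a_{i+1}/\alpha_{i+1}]$ (for $n=0$: $\Psi=\beta:\mathbb D$ and $\beta:\mathbb D\vdash a_1:\mathbb C_1$); it sends $\Phi\vdash s:R$ to $\Psi\vdash s[\phi]:R[a_1/\alpha_1;a_{n+1}/\alpha_{n+1}]$. Equality is the congruence generated by the $\beta\eta$ rules (extensional style). **Connectives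 used here** (VETT also has product and unit categories, graphs of profunctors, negative presheaf categories, cartesian products of sets, and meta-language types, not needed for this statement). - Positive presheaves $\mathcal P^+\mathbb D$ (a category, for $\mathbb D$ small): $\alpha:\mathbb C\vdash\lambda\beta{:}\mathbb D.R:\mathcal P^+\mathbb D$ for $R$ a set in $\alpha:\mathbb C;\beta:\mathbb D$; and a set $p\ni a$ in $\Xi$ for $d^-\Xi\vdash p:\mathcal P^+\mathbb D$, $d^+\Xi\vdash a:\mathbb D$; $((\lambda\beta.R)\ni b)=R[b/\beta]$, $p=\lambda\beta.(p\ni\beta)$. - Unit: for $d^-\Xi\vdash a:\mathbb C$, $d^+\Xi\vdash b:\mathbb C$, a set $a\to_{\mathbb C}b$ in $\Xi$. Introduction $\beta:\mathbb D\vdash\mathrm{id}_a:a\to_{\mathbb C}a$ for $\beta:\mathbb D\vdash a:\mathbb C$. Elimination: from a set $P$ in $\alpha:\mathbb C;\beta:\mathbb C$, $\alpha:\mathbb C\vdash t:P[\alpha/\alpha;\alpha/\beta]$ and $\Phi\vdash s:a\to_{\mathbb C}b$, infer $\Phi\vdash\mathrm{ind}_\to(\alpha.t,a,s,b):P[a/\alpha;b/\beta]$. $\beta$: $\mathrm{ind}_\to(\alpha.t,a,\mathrm{id}_a,a)=t[a/\alpha]$. $\eta$: for $\alpha_1:\mathbb C,z:\alpha_1\to_{\mathbb C}\alpha_2,\alpha_2:\mathbb C\vdash s:R$, $s=\mathrm{ind}_\to(\alpha.s[\alpha/\alpha_1,\mathrm{id}_\alpha/z,\alpha/\alpha_2],\alpha_1,z,\alpha_2)$.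 - Tensor: for $\mathbb D$ small, $P$ a set in $d^-\Xi;\beta:\mathbb D$, $Q$ in $\beta:\mathbb D;d^+\Xi$, a set $P\odot^{\exists\beta:\mathbb D}Q$ in $\Xi$. Introduction: $\Psi_s\Join\Psi_t\vdash(s,b,t):P\odot^{\exists\beta}Q$ for $d^+\Psi_s\vdash b:\mathbb D$, $\Psi_s\vdash s:P[b/\beta]$, $\Psi_t\vdash t:Q[b/\beta]$. Elimination: from $\Phi_l\Join(x:P,\beta:\mathbb D,y:Q)\Join\Phi_r\vdash t:R$ and $\Phi_m\vdash s:P\odot^{\exists\beta}Q$ infer $\Phi_l\Join\Phi_m\Join\Phi_r\vdash\mathrm{ind}_\odot(x,\beta,y.t;s):R$. $\beta$: $\mathrm{ind}_\odot(x,\beta,y.r;(s,b,t))=r[s/x,b/\beta,t/y]$. $\eta$: $s=\mathrm{ind}_\odot(x,\beta,y.s[(x,\beta,y)/z];z)$ for any element $s$ with a variable $z:P\odot^{\exists\beta}Q$ in its context. - Right hom: if the category of $d^+\Xi$ is small, $R$ a set in $d^+\Xi;\alpha:\mathbb C$, $P$ a set in $d^-\Xi;\alpha:\mathbb C$, a set $R\triangleright^{\forall\alpha:\mathbb C}P$ in $\Xi$. From $\Phi,x:R,\alpha:\mathbb C\vdash t:P$ infer $\Phi\vdash\lambda^\triangleright(x,\alpha).t:R\triangleright^{\forall\alpha}P$; from $\Phi_f\vdash s:R\triangleright^{\forall\alpha}P$, $d^+\Phi_a\vdash a:\mathbb C$, $\Phi_a\vdash t:R[a/\alpha]$ infer $\Phi_f\Join\Phi_a\vdash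 s\triangleright^at:P[a/\alpha]$; $\beta$: $(\lambda^\triangleright(x,\alpha).s)\triangleright^at=s[t/x,a/\alpha]$; $\eta$: $s=\lambda^\triangleright(x,\alpha).(s\triangleright^\alpha x)$. - Left hom: if the category of $d^-\Xi$ is small, $R$ a set in $\alpha:\mathbb C;d^-\Xi$, $P$ a set in $\alpha:\mathbb C;d^+\Xi$, a set $P\,{}^{\forall\alpha:\mathbb C}\!\triangleleft R$ in $\Xi$. From $\alpha:\mathbb C,x:R,\Phi\vdash t:P$ infer $\Phi\vdash\lambda^\triangleleft(\alpha,x).t:P\,{}^{\forall\alpha}\!\triangleleft R$; from $d^-\Phi_a\vdash a:\mathbb C$, $\Phi_a\vdash s:R[a/\alpha]$, $\Phi_f\vdash t:P\,{}^{\forall\alpha}\!\triangleleft R$ infer $\Phi_a\Join\Phi_f\vdash s\,{}^a\!\triangleleft t:P[a/\alpha]$; $\beta$: $s\,{}^a\!\triangleleft(\lambda^\triangleleft(\alpha,x).t)=t[a/\alpha,s/x]$; $\eta$: $t=\lambda^\triangleleft(\alpha,x).(x\,{}^\alpha\!\triangleleft t)$. **Isomorphism.** Sets $R,S$ in the same context $\alpha:\mathbb C;\beta:\mathbb D$ are isomorphic if there are elements $\alpha:\mathbb C,x:R,\beta:\mathbb D\vdash s:S$ and $\alpha:\mathbb C,y:S,\beta:\mathbb D\vdash t:R$ with $s[t/x]=y$ and $t[s/y]=x$. *)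

(* Defs.v *)
(* A deep embedding of the part of virtual equipment type theory (VETT) made of
   positive presheaf categories, units, tensors, and right and left homs.

   The ambient dependent context Gamma enters through a signature of category,
   functor, profunctor and transformation symbols, which stand for whatever
   Gamma makes available.

   The syntax is nameless and needs no indices:
   - an object has exactly one free variable, [ovar];
   - in a set, every object occurs on the contravariant or on the covariant side,
     so [ovar] denotes the variable of that side (in a context with a single
     variable the two sides denote the same variable);
   - element variables are ordered and linear, so an element [evar] uses up the
     single variable of its own context, and the context of a compound element
     is split according to the number of variables of each part. *)

Set Implicit Arguments.
Unset Strict Implicit.
Unset Printing Implicit Defensive.

(** * Categories *)

Record cat_signature : Type := CatSignature {
  cat_sym : Type;
  small_sym : cat_sym -> Prop }.

Inductive cat (K : cat_signature) : Type :=
| cbase (c : cat_sym K)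
| psh (D : cat K).            (* positive presheaves on D *)

Arguments cbase {K} c.
Arguments psh {K} D.

(* Categories of presheaves are never small. *)
Definition small (K : cat_signature) (C : cat K) : Prop :=
  match C with
  | cbase c => small_sym c
  | psh _ => False
  end.

Definition is_cat (K : cat_signature) (C : cat K) : Prop :=
  match C with
  | cbase _ => True
  | psh D => small D
  end.

Record signature : Type := Signature {
  sig_cat :> cat_signature;
  obj_sym : Type;
  obj_dom : obj_sym -> cat sig_cat;
  obj_cod : obj_sym -> cat sig_cat;
  set_sym : Type;
  set_neg : set_sym -> cat sig_cat;
  set_pos : set_sym -> cat sig_cat;
  obj_dom_ok : forall f, is_cat (obj_dom f);
  obj_cod_ok : forall f, is_cat (obj_cod f);
  set_neg_ok : forall X, is_cat (set_neg X);
  set_pos_ok : forall X, is_cat (set_pos X) }.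

(** * Objects and sets *)

Inductive obj (S : signature) : Type :=
| ovar
| osym (f : obj_sym S) (a : obj S)
| olam (D : cat S) (R : sset S)             (* lambda beta : D. R *)
with sset (S : signature) : Type :=
| ssym (X : set_sym S) (a b : obj S)
| mem (p a : obj S)                         (* p \ni a *)
| hom (C : cat S) (a b : obj S)             (* a ->_C b *)
| tens (D : cat S) (P Q : sset S)           (* P (.)^{exists beta : D} Q *)
| rhom (C : cat S) (R P : sset S)           (* R |>^{forall alpha : C} P *)
| lhom (C : cat S) (P R : sset S).          (* P ^{forall alpha : C}<| R *)

Arguments ovar {S}.

(* [osubst c a] is a[c/gamma], for gamma the variable of a, and [ssubst a b R] is
   R[a/alpha; b/beta].  A binder binds one side of each of its immediate subsets,
   which is why [ovar] is substituted there; the other side of that subset may be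
   the opposite one of the whole set, as for R in [rhom C R P]. *)
Fixpoint osubst (S : signature) (c a : obj S) {struct a} : obj S :=
  match a with
  | ovar => c
  | osym f a => osym f (osubst c a)
  | olam D R => olam D (ssubst c ovar R)
  end
with ssubst (S : signature) (a b : obj S) (R : sset S) {struct R} : sset S :=
  match R with
  | ssym X p q => ssym X (osubst a p) (osubst b q)
  | mem p q => mem (osubst a p) (osubst b q)
  | hom C p q => hom C (osubst a p) (osubst b q)
  | tens D P Q => tens D (ssubst a ovar P) (ssubst ovar b Q)
  | rhom C R P => rhom C (ssubst b ovar R) (ssubst a ovar P)
  | lhom C P R => lhom C (ssubst ovar b P) (ssubst ovar a R)
  end.

Inductive set_ctx (S : signature) : Type :=
| one (C : cat S)
| two (C D : cat S).

Definition neg (S : signature) (X : set_ctx S) : cat S :=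
  match X with one C => C | two C _ => C end.

Definition pos (S : signature) (X : set_ctx S) : cat S :=
  match X with one C => C | two _ D => D end.

(* [is_obj C a D] is alpha : C |- a : D, and [is_set X R] is X |- R Set. *)
Inductive is_obj (S : signature) : cat S -> obj S -> cat S -> Prop :=
| is_ovar C :
    is_cat C -> is_obj C ovar C
| is_osym C f a :
    is_obj C a (obj_dom f) -> is_obj C (osym f a) (obj_cod f)
| is_olam C D R :
    small D -> is_set (two C D) R -> is_obj C (olam D R) (psh D)
with is_set (S : signature) : set_ctx S -> sset S -> Prop :=
| is_ssym X Y a b :
    is_obj (neg X) a (set_neg Y) -> is_obj (pos X) b (set_pos Y) ->
    is_set X (ssym Y a b)
| is_mem X D p a :
    small D -> is_obj (neg X) p (psh D) -> is_obj (pos X) a D ->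
    is_set X (mem p a)
| is_hom X C a b :
    is_obj (neg X) a C -> is_obj (pos X) b C -> is_set X (hom C a b)
| is_tens X D P Q :
    small D -> is_set (two (neg X) D) P -> is_set (two D (pos X)) Q ->
    is_set X (tens D P Q)
| is_rhom X C R P :
    small (pos X) -> is_set (two (pos X) C) R -> is_set (two (neg X) C) P ->
    is_set X (rhom C R P)
| is_lhom X C P R :
    small (neg X) -> is_set (two C (neg X)) R -> is_set (two C (pos X)) P ->
    is_set X (lhom C P R).

(* [eq_obj C a b D] is alpha : C |- a = b : D, and [eq_set X P Q] is
   X |- P = Q Set. *)
Inductive eq_obj (S : signature) : cat S -> obj S -> obj S -> cat S -> Prop :=
| eq_obj_refl C a D :
    is_obj C a D -> eq_obj C a a D
| eq_obj_sym C a b D :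
    eq_obj C a b D -> eq_obj C b a D
| eq_obj_trans C a b c D :
    eq_obj C a b D -> eq_obj C b c D -> eq_obj C a c D
| eq_osym C f a a' :
    eq_obj C a a' (obj_dom f) -> eq_obj C (osym f a) (osym f a') (obj_cod f)
| eq_olam C D R R' :
    small D -> eq_set (two C D) R R' -> eq_obj C (olam D R) (olam D R') (psh D)
| eq_psh_eta C D p :
    is_obj C p (psh D) -> eq_obj C p (olam D (mem p ovar)) (psh D)
with eq_set (S : signature) : set_ctx S -> sset S -> sset S -> Prop :=
| eq_set_refl X R :
    is_set X R -> eq_set X R R
| eq_set_sym X P Q :
    eq_set X P Q -> eq_set X Q P
| eq_set_trans X P Q R :
    eq_set X P Q -> eq_set X Q R -> eq_set X P R
| eq_ssym X Y a a' b b' :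
    eq_obj (neg X) a a' (set_neg Y) -> eq_obj (pos X) b b' (set_pos Y) ->
    eq_set X (ssym Y a b) (ssym Y a' b')
| eq_mem X D p p' a a' :
    small D -> eq_obj (neg X) p p' (psh D) -> eq_obj (pos X) a a' D ->
    eq_set X (mem p a) (mem p' a')
| eq_hom X C a a' b b' :
    eq_obj (neg X) a a' C -> eq_obj (pos X) b b' C ->
    eq_set X (hom C a b) (hom C a' b')
| eq_tens X D P P' Q Q' :
    small D -> eq_set (two (neg X) D) P P' -> eq_set (two D (pos X)) Q Q' ->
    eq_set X (tens D P Q) (tens D P' Q')
| eq_rhom X C R R' P P' :
    small (pos X) -> eq_set (two (pos X) C) R R' ->
    eq_set (two (neg X) C) P P' -> eq_set X (rhom C R P) (rhom C R' P')
| eq_lhom X C P P' R R' :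
    small (neg X) -> eq_set (two C (neg X)) R R' ->
    eq_set (two C (pos X)) P P' -> eq_set X (lhom C P R) (lhom C P' R')
| eq_psh_beta X D R b :
    small D -> is_set (two (neg X) D) R -> is_obj (pos X) b D ->
    eq_set X (mem (olam D R) b) (ssubst ovar b R).

(** * Transformation contexts *)

(* alpha_1 : C_1, x_1 : R_1, ..., x_n : R_n, alpha_{n+1} : C_{n+1} *)
Inductive tctx (S : signature) : Type :=
| tnil (C : cat S)
| tcons (C : cat S) (R : sset S) (Phi : tctx S).

Fixpoint tlen (S : signature) (Phi : tctx S) : nat :=
  match Phi with
  | tnil _ => 0
  | tcons _ _ Phi => Datatypes.S (tlen Phi)
  end.

Definition dneg (S : signature) (Phi : tctx S) : cat S :=
  match Phi with tnil C => C | tcons C _ _ => C end.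

Fixpoint dpos (S : signature) (Phi : tctx S) : cat S :=
  match Phi with
  | tnil C => C
  | tcons _ _ Phi => dpos Phi
  end.

Definition under (S : signature) (Phi : tctx S) : set_ctx S :=
  match Phi with
  | tnil C => one C
  | tcons C _ Phi => two C (dpos Phi)
  end.

(* Only meaningful when [dpos Phi = dneg Psi]. *)
Fixpoint join (S : signature) (Phi Psi : tctx S) : tctx S :=
  match Phi with
  | tnil _ => Psi
  | tcons C R Phi => tcons C R (join Phi Psi)
  end.

Fixpoint is_tctx (S : signature) (Phi : tctx S) : Prop :=
  match Phi with
  | tnil C => is_cat C
  | tcons C R Phi => is_cat C /\ is_set (two C (dneg Phi)) R /\ is_tctx Phi
  end.

(* alpha : C, x : R, beta : D *)
Definition single (S : signature) (C : cat S) (R : sset S) (D : cat S) : tctx S :=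
  tcons C R (tnil D).

Record theory : Type := Theory {
  thy_sig :> signature;
  elt_sym : Type;
  elt_ctx : elt_sym -> tctx thy_sig;
  elt_typ : elt_sym -> sset thy_sig;
  elt_ctx_ok : forall k, is_tctx (elt_ctx k);
  elt_typ_ok : forall k, is_set (under (elt_ctx k)) (elt_typ k) }.

(** * Elements and transformation substitutions *)

Inductive elt (T : theory) : Type :=
| evar
| esym (k : elt_sym T) (phi : tsubst T)
| eid (a : obj T)
| ind_hom (t : elt T) (a : obj T) (s : elt T) (b : obj T)
    (* ind_->(alpha. t, a, s, b) *)
| pair (s : elt T) (b : obj T) (t : elt T)
| ind_tens (l : nat) (t : elt T) (s : elt T)
    (* ind_(.)(x, beta, y. t; s), where x and y are the element variables of t
       numbered l and l + 1, counting from 0 *)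
| rlam (t : elt T)                          (* binds the last element variable *)
| rapp (s : elt T) (a : obj T) (t : elt T)  (* s |>^a t *)
| llam (t : elt T)                          (* binds the first element variable *)
| lapp (s : elt T) (a : obj T) (t : elt T)  (* s ^a<| t *)
with tsubst (T : theory) : Type :=          (* a_1, s_1, a_2, ..., s_n, a_{n+1} *)
| unil (a : obj T)
| ucons (a : obj T) (s : elt T) (phi : tsubst T).

Arguments evar {T}.

(* The number of variables in the context of an element, and in the domain of a
   substitution.  Both variables bound by [ind_tens] are variables of [t]. *)
Fixpoint arity (T : theory) (s : elt T) {struct s} : nat :=
  match s with
  | evar => 1
  | esym _ phi => uarity phi
  | eid _ => 0
  | ind_hom _ _ s _ => arity s
  | pair s _ t => arity s + arity t
  | ind_tens _ t s => arity t - 2 + arity s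
  | rlam t => arity t - 1
  | rapp s _ t => arity s + arity t
  | llam t => arity t - 1
  | lapp s _ t => arity s + arity t
  end
with uarity (T : theory) (phi : tsubst T) {struct phi} : nat :=
  match phi with
  | unil _ => 0
  | ucons _ s phi => arity s + uarity phi
  end.

Definition ufst (T : theory) (phi : tsubst T) : obj T :=
  match phi with unil a => a | ucons a _ _ => a end.

Fixpoint ulast (T : theory) (phi : tsubst T) : obj T :=
  match phi with
  | unil a => a
  | ucons _ _ phi => ulast phi
  end.

(* [utake n phi] and [udrop n phi] share the object a_{n+1}, and [ujoin] expects
   its arguments to share an object in the same way. *)
Fixpoint utake (T : theory) (n : nat) (phi : tsubst T) {struct n} : tsubst T :=
  match n, phi with
  | S n, ucons a s phi => ucons a s (utake n phi)
  | _, _ => unil (ufst phi)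
  end.

Fixpoint udrop (T : theory) (n : nat) (phi : tsubst T) {struct n} : tsubst T :=
  match n, phi with
  | S n, ucons _ _ phi => udrop n phi
  | _, _ => phi
  end.

Fixpoint ujoin (T : theory) (phi psi : tsubst T) : tsubst T :=
  match phi with
  | unil _ => psi
  | ucons a s phi => ucons a s (ujoin phi psi)
  end.

(* The identity substitution of a context with n element variables. *)
Fixpoint uid (T : theory) (n : nat) : tsubst T :=
  match n with
  | 0 => unil ovar
  | S n => ucons ovar evar (uid T n)
  end.

(* [esubst phi s] is s[phi], and [usubst phi psi] is the composite substitution
   psi[phi].  The first argument of [ind_hom] lives in a context of its own and
   is left alone. *)
Fixpoint esubst (T : theory) (phi : tsubst T) (s : elt T) {struct s} : elt T :=
  match s with
  | evar => match phi with ucons _ s _ => s | unil _ => evar end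
  | esym k psi => esym k (usubst phi psi)
  | eid a => eid (osubst (ufst phi) a)
  | ind_hom t a s b =>
      ind_hom t (osubst (ufst phi) a) (esubst phi s) (osubst (ulast phi) b)
  | pair s b t =>
      let n := arity s in
      pair (esubst (utake n phi) s) (osubst (ufst (udrop n phi)) b)
           (esubst (udrop n phi) t)
  | ind_tens l t s =>
      let m := arity s in
      let phi_l := utake l phi in
      let phi_m := utake m (udrop l phi) in
      let phi_r := udrop m (udrop l phi) in
      ind_tens (uarity phi_l)
        (esubst (ujoin phi_l
                   (ucons (ulast phi_l) evar (ucons ovar evar phi_r))) t)
        (esubst phi_m s)
  | rlam t =>
      rlam (esubst (ujoin phi (ucons (ulast phi) evar (unil ovar))) t)
  | rapp s a t =>
      let n := arity s in
      rapp (esubst (utake n phi) s) (osubst (ulast phi) a)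
           (esubst (udrop n phi) t)
  | llam t => llam (esubst (ucons ovar evar phi) t)
  | lapp s a t =>
      let n := arity s in
      lapp (esubst (utake n phi) s) (osubst (ufst phi) a)
           (esubst (udrop n phi) t)
  end
with usubst (T : theory) (phi psi : tsubst T) {struct psi} : tsubst T :=
  match psi with
  | unil a => unil (osubst (ufst phi) a)
  | ucons a s psi =>
      let n := arity s in
      ucons (osubst (ufst phi) a) (esubst (utake n phi) s)
            (usubst (udrop n phi) psi)
  end.

(* [is_elt Phi s R] is Phi |- s : R, and [is_tsubst Psi phi Phi] is
   Psi |- phi :: Phi.  The first rule after the variable rule is conversion,
   implicit in the extensional style. *)
Inductive is_elt (T : theory) : tctx T -> elt T -> sset T -> Prop :=
| is_evar C R D :
    is_cat C -> is_cat D -> is_set (two C D) R ->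
    is_elt (single C R D) evar R
| is_conv Phi s R R' :
    is_elt Phi s R -> eq_set (under Phi) R R' -> is_elt Phi s R'
| is_esym Psi k phi :
    is_tsubst Psi phi (elt_ctx k) ->
    is_elt Psi (esym k phi) (ssubst (ufst phi) (ulast phi) (elt_typ k))
| is_eid D a C :
    is_obj D a C -> is_elt (tnil D) (eid a) (hom C a a)
| is_ind_hom Phi C P t a s b :
    is_set (two C C) P -> is_elt (tnil C) t (ssubst ovar ovar P) ->
    is_obj (dneg Phi) a C -> is_obj (dpos Phi) b C ->
    is_elt Phi s (hom C a b) ->
    is_elt Phi (ind_hom t a s b) (ssubst a b P)
| is_pair Psi_s Psi_t D P Q s b t :
    dpos Psi_s = dneg Psi_t ->
    is_set (under (join Psi_s Psi_t)) (tens D P Q) ->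
    is_obj (dpos Psi_s) b D ->
    is_elt Psi_s s (ssubst ovar b P) -> is_elt Psi_t t (ssubst b ovar Q) ->
    is_elt (join Psi_s Psi_t) (pair s b t) (tens D P Q)
| is_ind_tens Phi_l Phi_m Phi_r D P Q R t s :
    dpos Phi_l = dneg Phi_m -> dpos Phi_m = dneg Phi_r ->
    is_elt (join Phi_l (join (tcons (dneg Phi_m) P (single D Q (dpos Phi_m)))
                             Phi_r)) t R ->
    is_elt Phi_m s (tens D P Q) ->
    is_elt (join Phi_l (join Phi_m Phi_r)) (ind_tens (tlen Phi_l) t s) R
| is_rlam Phi C R P t :
    is_set (under Phi) (rhom C R P) ->
    is_elt (join Phi (single (dpos Phi) R C)) t P ->
    is_elt Phi (rlam t) (rhom C R P)
| is_rapp Phi_f Phi_a C R P s a t :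
    dpos Phi_f = dneg Phi_a ->
    is_elt Phi_f s (rhom C R P) -> is_obj (dpos Phi_a) a C ->
    is_elt Phi_a t (ssubst ovar a R) ->
    is_elt (join Phi_f Phi_a) (rapp s a t) (ssubst ovar a P)
| is_llam Phi C P R t :
    is_set (under Phi) (lhom C P R) ->
    is_elt (join (single C R (dneg Phi)) Phi) t P ->
    is_elt Phi (llam t) (lhom C P R)
| is_lapp Phi_a Phi_f C P R s a t :
    dpos Phi_a = dneg Phi_f ->
    is_obj (dneg Phi_a) a C -> is_elt Phi_a s (ssubst a ovar R) ->
    is_elt Phi_f t (lhom C P R) ->
    is_elt (join Phi_a Phi_f) (lapp s a t) (ssubst a ovar P)
with is_tsubst (T : theory) : tctx T -> tsubst T -> tctx T -> Prop :=
| is_unil D a C :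
    is_obj D a C -> is_tsubst (tnil D) (unil a) (tnil C)
| is_ucons Psi Psi' C R Phi a s phi :
    dpos Psi = dneg Psi' -> is_set (two C (dneg Phi)) R ->
    is_obj (dneg Psi) a C -> is_elt Psi s (ssubst a (ufst phi) R) ->
    is_tsubst Psi' phi Phi ->
    is_tsubst (join Psi Psi') (ucons a s phi) (tcons C R Phi).

(* [eq_elt Phi s t R] is Phi |- s = t : R: the least congruence, stable under
   substitution, that contains the beta and eta rules. *)
Inductive eq_elt (T : theory) : tctx T -> elt T -> elt T -> sset T -> Prop :=
| eq_elt_refl Phi s R :
    is_elt Phi s R -> eq_elt Phi s s R
| eq_elt_sym Phi s t R :
    eq_elt Phi s t R -> eq_elt Phi t s R
| eq_elt_trans Phi s t u R :
    eq_elt Phi s t R -> eq_elt Phi t u R -> eq_elt Phi s u R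
| eq_conv Phi s t R R' :
    eq_elt Phi s t R -> eq_set (under Phi) R R' -> eq_elt Phi s t R'
| eq_esubst Psi Phi s t R phi psi :
    eq_elt Phi s t R -> eq_tsubst Psi phi psi Phi ->
    eq_elt Psi (esubst phi s) (esubst psi t) (ssubst (ufst phi) (ulast phi) R)
| eq_esym Psi k phi psi :
    eq_tsubst Psi phi psi (elt_ctx k) ->
    eq_elt Psi (esym k phi) (esym k psi)
      (ssubst (ufst phi) (ulast phi) (elt_typ k))
| eq_eid D a a' C :
    eq_obj D a a' C -> eq_elt (tnil D) (eid a) (eid a') (hom C a a)
| eq_ind_hom Phi C P t t' a a' s s' b b' :
    is_set (two C C) P -> eq_elt (tnil C) t t' (ssubst ovar ovar P) ->
    eq_obj (dneg Phi) a a' C -> eq_obj (dpos Phi) b b' C ->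
    eq_elt Phi s s' (hom C a b) ->
    eq_elt Phi (ind_hom t a s b) (ind_hom t' a' s' b') (ssubst a b P)
| eq_pair Psi_s Psi_t D P Q s s' b b' t t' :
    dpos Psi_s = dneg Psi_t ->
    is_set (under (join Psi_s Psi_t)) (tens D P Q) ->
    eq_obj (dpos Psi_s) b b' D ->
    eq_elt Psi_s s s' (ssubst ovar b P) -> eq_elt Psi_t t t' (ssubst b ovar Q) ->
    eq_elt (join Psi_s Psi_t) (pair s b t) (pair s' b' t') (tens D P Q)
| eq_ind_tens Phi_l Phi_m Phi_r D P Q R t t' s s' :
    dpos Phi_l = dneg Phi_m -> dpos Phi_m = dneg Phi_r ->
    eq_elt (join Phi_l (join (tcons (dneg Phi_m) P (single D Q (dpos Phi_m)))
                             Phi_r)) t t' R ->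
    eq_elt Phi_m s s' (tens D P Q) ->
    eq_elt (join Phi_l (join Phi_m Phi_r))
      (ind_tens (tlen Phi_l) t s) (ind_tens (tlen Phi_l) t' s') R
| eq_rlam Phi C R P t t' :
    is_set (under Phi) (rhom C R P) ->
    eq_elt (join Phi (single (dpos Phi) R C)) t t' P ->
    eq_elt Phi (rlam t) (rlam t') (rhom C R P)
| eq_rapp Phi_f Phi_a C R P s s' a a' t t' :
    dpos Phi_f = dneg Phi_a ->
    eq_elt Phi_f s s' (rhom C R P) -> eq_obj (dpos Phi_a) a a' C ->
    eq_elt Phi_a t t' (ssubst ovar a R) ->
    eq_elt (join Phi_f Phi_a) (rapp s a t) (rapp s' a' t') (ssubst ovar a P)
| eq_llam Phi C P R t t' :
    is_set (under Phi) (lhom C P R) ->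
    eq_elt (join (single C R (dneg Phi)) Phi) t t' P ->
    eq_elt Phi (llam t) (llam t') (lhom C P R)
| eq_lapp Phi_a Phi_f C P R s s' a a' t t' :
    dpos Phi_a = dneg Phi_f ->
    eq_obj (dneg Phi_a) a a' C -> eq_elt Phi_a s s' (ssubst a ovar R) ->
    eq_elt Phi_f t t' (lhom C P R) ->
    eq_elt (join Phi_a Phi_f) (lapp s a t) (lapp s' a' t') (ssubst a ovar P)
| eq_hom_beta D C P t a :
    is_set (two C C) P -> is_elt (tnil C) t (ssubst ovar ovar P) ->
    is_obj D a C ->
    eq_elt (tnil D) (ind_hom t a (eid a) a) (esubst (unil a) t) (ssubst a a P)
| eq_hom_eta C s R :
    is_elt (single C (hom C ovar ovar) C) s R ->
    eq_elt (single C (hom C ovar ovar) C) s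
      (ind_hom (esubst (ucons ovar (eid ovar) (unil ovar)) s) ovar evar ovar) R
| eq_tens_beta Phi_l Psi_s Psi_t Phi_r D P Q R r s b t :
    dpos Phi_l = dneg Psi_s -> dpos Psi_s = dneg Psi_t ->
    dpos Psi_t = dneg Phi_r ->
    is_elt (join Phi_l (join (tcons (dneg Psi_s) P (single D Q (dpos Psi_t)))
                             Phi_r)) r R ->
    is_obj (dpos Psi_s) b D ->
    is_elt Psi_s s (ssubst ovar b P) -> is_elt Psi_t t (ssubst b ovar Q) ->
    is_set (under (join Psi_s Psi_t)) (tens D P Q) ->
    eq_elt (join Phi_l (join (join Psi_s Psi_t) Phi_r))
      (ind_tens (tlen Phi_l) r (pair s b t))
      (esubst (ujoin (uid T (tlen Phi_l))
                 (ucons ovar s (ucons b t (uid T (tlen Phi_r))))) r) R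
| eq_tens_eta Phi_l Phi_r D P Q R s :
    is_elt (join Phi_l (join (single (dpos Phi_l) (tens D P Q) (dneg Phi_r))
                             Phi_r)) s R ->
    eq_elt (join Phi_l (join (single (dpos Phi_l) (tens D P Q) (dneg Phi_r))
                             Phi_r)) s
      (ind_tens (tlen Phi_l)
         (esubst (ujoin (uid T (tlen Phi_l))
                    (ucons ovar (pair evar ovar evar) (uid T (tlen Phi_r)))) s)
         evar) R
| eq_rhom_beta Phi_f Phi_a C R P s a t :
    dpos Phi_f = dneg Phi_a ->
    is_set (under Phi_f) (rhom C R P) ->
    is_elt (join Phi_f (single (dpos Phi_f) R C)) s P ->
    is_obj (dpos Phi_a) a C -> is_elt Phi_a t (ssubst ovar a R) ->
    eq_elt (join Phi_f Phi_a) (rapp (rlam s) a t)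
      (esubst (ujoin (uid T (tlen Phi_f)) (ucons ovar t (unil a))) s)
      (ssubst ovar a P)
| eq_rhom_eta Phi C R P s :
    is_elt Phi s (rhom C R P) ->
    eq_elt Phi s (rlam (rapp s ovar evar)) (rhom C R P)
| eq_lhom_beta Phi_a Phi_f C P R s a t :
    dpos Phi_a = dneg Phi_f ->
    is_set (under Phi_f) (lhom C P R) ->
    is_obj (dneg Phi_a) a C -> is_elt Phi_a s (ssubst a ovar R) ->
    is_elt (join (single C R (dneg Phi_f)) Phi_f) t P ->
    eq_elt (join Phi_a Phi_f) (lapp s a (llam t))
      (esubst (ucons a s (uid T (tlen Phi_f))) t) (ssubst a ovar P)
| eq_lhom_eta Phi C P R t :
    is_elt Phi t (lhom C P R) ->
    eq_elt Phi t (llam (lapp evar ovar t)) (lhom C P R)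
with eq_tsubst (T : theory) : tctx T -> tsubst T -> tsubst T -> tctx T -> Prop :=
| eq_unil D a a' C :
    eq_obj D a a' C -> eq_tsubst (tnil D) (unil a) (unil a') (tnil C)
| eq_ucons Psi Psi' C R Phi a a' s s' phi phi' :
    dpos Psi = dneg Psi' -> is_set (two C (dneg Phi)) R ->
    eq_obj (dneg Psi) a a' C -> eq_elt Psi s s' (ssubst a (ufst phi) R) ->
    eq_tsubst Psi' phi phi' Phi ->
    eq_tsubst (join Psi Psi') (ucons a s phi) (ucons a' s' phi') (tcons C R Phi).

(** * Isomorphism of sets *)

(* [inst t s] is s[t/x] for s in a context alpha : C, x : R, beta : D. *)
Definition inst (T : theory) (t s : elt T) : elt T :=
  esubst (ucons ovar t (unil ovar)) s.

Definition set_iso (T : theory) (C D : cat T) (R S : sset T) : Prop :=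
  is_set (two C D) R /\ is_set (two C D) S /\
  exists s t : elt T,
    is_elt (single C R D) s S /\
    is_elt (single C S D) t R /\
    eq_elt (single C S D) (inst t s) evar S /\
    eq_elt (single C R D) (inst s t) evar R.

(* Main.v *)
Require Import Defs.

(* For any set Q in B; C, unit elimination into "Q <| Q" (the set of maps
   from Q at alpha to Q at beta) makes Q covariantly functorial: from q : Q and
   z : alpha -> beta it gives [transport] : Q.  The isomorphisms are
     f |-> f |> id  and  q |-> lambda z. transport q z          (Yoneda),
     (q, z) |-> transport q z  and  q |-> (q, id)               (co-Yoneda).
   One composite is a beta computation.  For the other, [hom_ext] reduces an
   equation in the context q : Q, z : alpha -> beta to the case z = id. *)

Set Implicit Arguments.
Unset Strict Implicit.
Unset Printing Implicit Defensive.

(* Substituting variables for themselves *)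
Scheme obj_mut := Induction for obj Sort Prop
  with sset_mut := Induction for sset Sort Prop.
Combined Scheme obj_sset_ind from obj_mut, sset_mut.

Lemma osubst_ssubst_ovar (S : signature) :
  (forall a : obj S, osubst ovar a = a) /\
  (forall R : sset S, ssubst ovar ovar R = R).
Proof. apply obj_sset_ind; intros; simpl; congruence. Qed.

Lemma ssubst_ovar (S : signature) (R : sset S) : ssubst ovar ovar R = R.
Proof. apply osubst_ssubst_ovar. Qed.

Lemma is_elt_ssubst_ovar (T : theory) (Phi : tctx T) (s : elt T) (R : sset T) :
  is_elt Phi s (ssubst ovar ovar R) <-> is_elt Phi s R.
Proof. now rewrite ssubst_ovar. Qed.

Lemma eq_elt_ssubst_ovar (T : theory) (Phi : tctx T) (s t : elt T)
    (R : sset T) :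
  eq_elt Phi s t (ssubst ovar ovar R) <-> eq_elt Phi s t R.
Proof. now rewrite ssubst_ovar. Qed.

Lemma small_is_cat (K : cat_signature) (C : cat K) : small C -> is_cat C.
Proof. destruct C; simpl; tauto. Qed.

(* [ssubst ovar ovar R] is equal but not convertible to [R], so the typing rules
   at variables need restating. *)
Lemma is_lapp_ovar (T : theory) (Phi_a Phi_f : tctx T) (C : cat T)
    (P R : sset T) (s t : elt T) :
  dpos Phi_a = dneg Phi_f -> is_cat C -> dneg Phi_a = C ->
  is_elt Phi_a s R -> is_elt Phi_f t (lhom C P R) ->
  is_elt (join Phi_a Phi_f) (lapp s ovar t) P.
Proof.
intros e cC eC Hs Ht; apply is_elt_ssubst_ovar.
apply is_lapp with C R; trivial.
- rewrite eC; now constructor.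
- now apply is_elt_ssubst_ovar.
Qed.

Lemma eq_lapp_ovar (T : theory) (Phi_a Phi_f : tctx T) (C : cat T)
    (P R : sset T) (s s' t t' : elt T) :
  dpos Phi_a = dneg Phi_f -> is_cat C -> dneg Phi_a = C ->
  eq_elt Phi_a s s' R -> eq_elt Phi_f t t' (lhom C P R) ->
  eq_elt (join Phi_a Phi_f) (lapp s ovar t) (lapp s' ovar t') P.
Proof.
intros e cC eC Hs Ht; apply eq_elt_ssubst_ovar.
apply eq_lapp with C R; trivial.
- rewrite eC; now do 2 constructor.
- now apply eq_elt_ssubst_ovar.
Qed.

Lemma is_rapp_ovar (T : theory) (Phi_f Phi_a : tctx T) (C : cat T)
    (R P : sset T) (s t : elt T) :
  dpos Phi_f = dneg Phi_a -> is_cat C -> dpos Phi_a = C ->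
  is_elt Phi_f s (rhom C R P) -> is_elt Phi_a t R ->
  is_elt (join Phi_f Phi_a) (rapp s ovar t) P.
Proof.
intros e cC eC Hs Ht; apply is_elt_ssubst_ovar.
apply is_rapp with C R; trivial.
- rewrite eC; now constructor.
- now apply is_elt_ssubst_ovar.
Qed.

(** * Unit elimination and transport along [z] *)

Section Transport.

Variables (T : theory) (B C : cat T) (Q : sset T).
Hypotheses (B_cat : is_cat B) (C_small : small C) (Q_set : is_set (two B C) Q).

Let Hom : sset T := hom C ovar ovar.
Let Q_ctx : tctx T := single B Q C.
Let Hom_ctx : tctx T := single C Hom C.

Let C_cat : is_cat C := small_is_cat C_small.

Lemma is_set_Hom : is_set (two C C) Hom.
Proof. now apply is_hom; constructor. Qed.

(** Needed over both [one C], where the identity map of [Q] lives, and [two C C], where [z] does;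
    hence a general [X]. *)
Lemma is_set_lhom (X : set_ctx T) (R : sset T) :
  neg X = C -> pos X = C -> is_set (two B C) R -> is_set X (lhom B R Q).
Proof. intros eN eP HR; apply is_lhom; rewrite ?eN, ?eP; trivial. Qed.

Lemma is_elt_q : is_elt Q_ctx evar Q.
Proof. now constructor. Qed.

Lemma is_elt_z : is_elt Hom_ctx evar Hom.
Proof. now constructor; trivial; apply is_set_Hom. Qed.

Lemma is_elt_id : is_elt (tnil C) (eid ovar) Hom.
Proof. now do 2 constructor. Qed.

Lemma is_llam_q : is_elt (tnil C) (llam evar) (lhom B Q Q).
Proof. apply is_llam; [now apply is_set_lhom | apply is_elt_q]. Qed.

Lemma is_ind_z (t : elt T) (R : sset T) :
  is_set (two C C) R -> is_elt (tnil C) t R ->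
  is_elt Hom_ctx (ind_hom t ovar evar ovar) R.
Proof.
intros HR Ht; apply is_elt_ssubst_ovar.
apply is_ind_hom with C; try (now constructor); trivial.
- now rewrite ssubst_ovar.
- apply is_elt_z.
Qed.

(* Unit induction with z : alpha -> beta last in the context and q : Q before
   it: abstracting q leaves z alone, as the eta rule of the unit requires.  The
   hypotheses on [uid T 2] hold by computation for concrete elements. *)
Lemma hom_ext (R : sset T) (r r' : elt T) :
  is_set (two B C) R ->
  is_elt (join Q_ctx Hom_ctx) r R -> is_elt (join Q_ctx Hom_ctx) r' R ->
  esubst (uid T 2) r = r -> esubst (uid T 2) r' = r' ->
  let id_z := ucons ovar evar (ucons ovar (eid ovar) (unil ovar)) in
  eq_elt Q_ctx (esubst id_z r) (esubst id_z r') R ->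
  eq_elt (join Q_ctx Hom_ctx) r r' R.
Proof.
intros HR Hr Hr' er er' id_z E.
assert (LR : is_set (two C C) (lhom B R Q)) by now apply is_set_lhom.
assert (L : forall u, is_elt (join Q_ctx Hom_ctx) u R ->
            is_elt Hom_ctx (llam u) (lhom B R Q))
  by (intros u Hu; now apply is_llam).
(* Unit eta makes each side the induction on its own value at [id]; substitution passes under
   [llam], so these values are [llam] of the two sides of [E]. *)
assert (Ell : eq_elt Hom_ctx (llam r) (llam r') (lhom B R Q)).
{ eapply eq_elt_trans; [apply eq_hom_eta, L, Hr |].
  eapply eq_elt_trans; [| apply eq_elt_sym, eq_hom_eta, L, Hr'].
  apply eq_elt_ssubst_ovar.
  apply eq_ind_hom with C; try (now do 2 constructor); trivial.
  - rewrite ssubst_ovar; apply eq_llam; [now apply is_set_lhom | exact E].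
  - apply eq_elt_refl, is_elt_z. }
(* Applying to [q] undoes the abstraction, up to the identity substitution [uid T 2] left by the
   beta rule; [eu] removes it. *)
assert (beta : forall u, is_elt (join Q_ctx Hom_ctx) u R ->
               esubst (uid T 2) u = u ->
               eq_elt (join Q_ctx Hom_ctx) (lapp evar ovar (llam u)) u R).
{ intros u Hu eu.
  apply eq_elt_trans with (esubst (uid T 2) u);
    [| rewrite eu; now apply eq_elt_refl].
  apply eq_elt_ssubst_ovar, (@eq_lhom_beta T Q_ctx Hom_ctx B R Q evar ovar u); trivial.
  - now constructor.
  - rewrite ssubst_ovar; apply is_elt_q. }
eapply eq_elt_trans; [apply eq_elt_sym, beta; trivial |].
eapply eq_elt_trans; [| apply beta; trivial].
apply eq_lapp_ovar with B Q; trivial.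
apply eq_elt_refl, is_elt_q.
Qed.

Definition transport : elt T :=
  lapp evar ovar (ind_hom (llam evar) ovar evar ovar).

Lemma is_transport : is_elt (join Q_ctx Hom_ctx) transport Q.
Proof.
apply is_lapp_ovar with B Q; trivial; [apply is_elt_q |].
apply is_ind_z; [now apply is_set_lhom | apply is_llam_q].
Qed.

Lemma transport_id (Phi : tctx T) (q : elt T) :
  dneg Phi = B -> dpos Phi = C -> is_elt Phi q Q ->
  eq_elt (join Phi (tnil C))
    (lapp q ovar (ind_hom (llam evar) ovar (eid ovar) ovar)) q Q.
Proof.
intros eB eC Hq.
eapply eq_elt_trans.
- apply eq_lapp_ovar with B Q; trivial; [apply eq_elt_refl, Hq |].
  apply eq_elt_ssubst_ovar.
  apply (@eq_hom_beta T C C (lhom B Q Q)).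
  + now apply is_set_lhom.
  + rewrite ssubst_ovar; apply is_llam_q.
  + now constructor.
- apply eq_elt_ssubst_ovar.
  apply (@eq_lhom_beta T Phi (tnil C) B Q Q q ovar evar); trivial.
  + now apply is_set_lhom.
  + rewrite eB; now constructor.
  + now rewrite ssubst_ovar.
  + apply is_elt_q.
Qed.

End Transport.

(** * The two isomorphisms, for an arbitrary profunctor [Q] *)

Lemma yoneda (T : theory) (B C : cat T) (Q : sset T) :
  is_cat B -> small C -> is_set (two B C) Q ->
  set_iso B C (rhom C (hom C ovar ovar) Q) Q.
Proof.
intros B_cat C_small HQ.
set (Hom := hom C ovar ovar); set (F := rhom C Hom Q).
assert (C_cat := small_is_cat C_small).
assert (Hom_set : is_set (two C C) Hom) by now apply is_set_Hom.
assert (HF : is_set (two B C) F) by now apply is_rhom.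
assert (Hf : is_elt (single B F C) evar F) by now constructor.
assert (Hid : is_elt (tnil C) (eid ovar) Hom) by now apply is_elt_id.
set (tr := transport T).
assert (Htr : is_elt (join (single B Q C) (single C Hom C)) tr Q)
  by now apply is_transport.
set (at_id := rapp evar ovar (eid ovar) : elt T).
assert (Hs : is_elt (single B F C) at_id Q)
  by now apply (is_rapp_ovar (Phi_f := single B F C) (Phi_a := tnil C)
                  (C := C) (R := Hom)).
assert (Ht : is_elt (single B Q C) (rlam tr) F) by now apply is_rlam.
split; [exact HF |]; split; [exact HQ |].
exists at_id, (rlam tr).
split; [exact Hs |]; split; [exact Ht |]; split.
- eapply eq_elt_trans;
    [| apply (transport_id B_cat C_small HQ (Phi := single B Q C)); trivial;
       now apply is_elt_q].
  apply eq_elt_ssubst_ovar.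
  apply (@eq_rhom_beta T (single B Q C) (tnil C) C Hom Q tr ovar (eid ovar));
    trivial.
  now constructor.
(* Eta turns [f] into [lambda z. f |> z], leaving [f |> z = transport (f |> id) z]. *)
- apply eq_elt_sym; eapply eq_elt_trans; [apply eq_rhom_eta, Hf |].
  apply eq_rlam; [exact HF |].
  change (eq_elt (join (single B F C) (single C Hom C)) (rapp evar ovar evar)
            (lapp at_id ovar (ind_hom (llam evar) ovar evar ovar)) Q).
  (* The variable [f : F] plays the role of [q]. At [z = id] the claim says that transporting
     [f |> id] along [id] changes nothing. *)
  apply hom_ext; trivial.
  + apply (is_rapp_ovar (Phi_f := single B F C) (Phi_a := single C Hom C)
             (C := C) (R := Hom)); trivial; now apply is_elt_z.
  + apply (is_lapp_ovar (Phi_a := single B F C) (Phi_f := single C Hom C)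
             (C := B) (R := Q)); trivial.
    apply is_ind_z; trivial; [now apply is_set_lhom with C | now apply is_llam_q].
  + now apply eq_elt_sym, (transport_id B_cat C_small HQ (Phi := single B F C)).
Qed.

Lemma coyoneda (T : theory) (B C : cat T) (Q : sset T) :
  is_cat B -> small C -> is_set (two B C) Q ->
  set_iso B C (tens C Q (hom C ovar ovar)) Q.
Proof.
intros B_cat C_small HQ.
set (Hom := hom C ovar ovar); set (F := tens C Q Hom).
assert (C_cat := small_is_cat C_small).
assert (Hom_set : is_set (two C C) Hom) by now apply is_set_Hom.
assert (HF : is_set (two B C) F) by now apply is_tens.
assert (Hf : is_elt (single B F C) evar F) by now constructor.
assert (Hq : is_elt (single B Q C) evar Q) by now constructor.
assert (Hz : is_elt (single C Hom C) evar Hom) by now constructor.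
assert (Hid : is_elt (tnil C) (eid ovar) Hom) by now apply is_elt_id.
set (tr := transport T).
assert (Htr : is_elt (join (single B Q C) (single C Hom C)) tr Q)
  by now apply is_transport.
set (with_id := pair evar ovar (eid ovar) : elt T).
assert (Ht : is_elt (single B Q C) with_id F).
{ apply (@is_pair T (single B Q C) (tnil C) C Q Hom evar ovar (eid ovar));
    rewrite ?ssubst_ovar; trivial; now constructor. }
assert (Hs : is_elt (single B F C) (ind_tens 0 tr evar) Q).
{ now apply (@is_ind_tens T (tnil B) (single B F C) (tnil C) C Q Hom Q). }
(* This is one composite, and it returns below as the case [z = id] of the other. *)
assert (Eq : eq_elt (single B Q C) (ind_tens 0 tr with_id) evar Q).
{ eapply eq_elt_trans;
    [| now apply (transport_id B_cat C_small HQ (Phi := single B Q C))].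
  apply (@eq_tens_beta T (tnil B) (single B Q C) (tnil C) (tnil C) C Q Hom Q tr
           evar ovar (eid ovar)); rewrite ?ssubst_ovar; trivial; now constructor. }
split; [exact HF |]; split; [exact HQ |].
exists (ind_tens 0 tr evar), with_id.
split; [exact Hs |]; split; [exact Ht |]; split.
- exact Eq.
- assert (Htt : is_elt (single B F C)
                  (pair (ind_tens 0 tr evar) ovar (eid ovar)) F).
  { apply (@is_pair T (single B F C) (tnil C) C Q Hom);
      rewrite ?ssubst_ovar; trivial; now constructor. }
  (* Tensor eta presents both sides as inductions on the same variable, so comparing them on a pair
     [(q, z)] is enough. *)
  eapply eq_elt_trans;
    [apply (@eq_tens_eta T (tnil B) (tnil C) C Q Hom F _ Htt) |].
  apply eq_elt_sym; eapply eq_elt_trans;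
    [apply (@eq_tens_eta T (tnil B) (tnil C) C Q Hom F _ Hf) |].
  apply (@eq_ind_tens T (tnil B) (single B F C) (tnil C) C Q Hom F); trivial;
    [| now apply eq_elt_refl].
  change (eq_elt (join (single B Q C) (single C Hom C)) (pair evar ovar evar)
            (pair (ind_tens 0 tr (pair evar ovar evar)) ovar (eid ovar)) F).
  assert (Hqz : is_elt (join (single B Q C) (single C Hom C))
                  (pair evar ovar evar) F).
  { apply (@is_pair T (single B Q C) (single C Hom C) C Q Hom);
      rewrite ?ssubst_ovar; trivial; now constructor. }
  (* At [z = id] both sides are pairs with second component [id], and [Eq] identifies the first
     components. *)
  apply hom_ext; trivial.
  + apply (@is_pair T (join (single B Q C) (single C Hom C)) (tnil C) C Q Hom);
      rewrite ?ssubst_ovar; trivial; try now constructor.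
    now apply (@is_ind_tens T (tnil B) (join (single B Q C) (single C Hom C))
                 (tnil C) C Q Hom Q).
  + apply (@eq_pair T (single B Q C) (tnil C) C Q Hom);
      rewrite ?ssubst_ovar; trivial.
    * now do 2 constructor.
    * now apply eq_elt_sym.
    * now apply eq_elt_refl.
Qed.

Theorem lemma2 (T : theory) (C : cat T) (C_small : small C) :
  set_iso (psh C) C
    (rhom C (hom C ovar ovar) (mem ovar ovar))
    (mem ovar ovar) /\
  set_iso (psh C) C
    (tens C (mem ovar ovar) (hom C ovar ovar))
    (mem ovar ovar).
Proof.
assert (HM : is_set (two (psh C) C) (mem (@ovar T) ovar))
  by (apply is_mem with C; trivial; constructor; trivial; now apply small_is_cat).
(* [is_cat (psh C)] computes to [small C], so [C_small] supplies that premise. *)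
split; [now apply yoneda | now apply coyoneda].
Qed.
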